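(* For every graded matrix, the grade-queue version of Min_gens produces the same output as the LW version of Min_gens, and the grade-queue version of Ker_basis produces the same output as the LW version of Ker_basis.
   Context: Let $K=\mathbb{Z}_2$. Grades are elements of $\mathbb{Z}^2$ with the partial order $(g_x,g_y)\le(h_x,h_y)$ iff $g_x\le h_x$ and $g_y\le h_y$. Lexicographic order compares $x$ first, then $y$; co-lexicographic (colex) order compares $y$ first, then $x$. **Graded matrices.** A graded matrix is a finite matrix over $K$ with a grade attached to each row and column such that whenever the $(i,j)$-entry is $1$, the grade of row $i$ is $\le$ the grade of column $j$. Rows and columns are indexed in colex order of their grades (ties ordered arbitrarily but fixed). All grades are assumed to lie in $\{1,\dots,X\}\times\{1,\dots,Y\}$. The pivot of a non-zero column is its largest row index with a non-zero entry. **Reduction.** The algorithms modify the columns of the matrix in place and maintain a partial map $\rho$ (pivot map) from row indices to column indices, initially empty. Reducing column $i$ means: while column $i$ is non-zero, with pivot $j$, and $\rho(j)$ is defined with $\rho(j)<i$, add column $\rho(j)$ to column $i$. If the loop ends with column $i$ non-zero, with pivot $j$, set $\rho(j):=i$ (possibly overwriting a previous value). In Ker_basis, every column $i$ additionally carries an auxiliary vector, initially the unit vector $e_i$; whenever column $k$ is added to column $i$, the auxiliary vector of $k$ is also added to that of $i$. **LW versions.** Traverse all grid cells $(x,y)\in\{1,\dots,X\}\times\{1,\dots,Y\}$ in lexicographic order, handling each cell as follows. - Min_gens: reduce all columns of grade $(1,y),(2,y),\dots,(x-1,y)$ in increasing index order; then reduce each column of grade $(x,y)$ in increasing index order, and append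 each such column that does not reduce to $0$ to the output list, with grade $(x,y)$. - Ker_basis: reduce all columns of grade $(1,y),\dots,(x,y)$ in increasing index order; whenever one of these columns turns from non-zero to zero during its reduction, append its auxiliary vector to the output list, with grade $(x,y)$. The output is the ordered list of graded columns produced. **Grade-queue versions.** These maintain a priority queue $Q$ of grades, ordered lexicographically (with no repeated entries), initialized with all grades of columns of the matrix. Instead of traversing all grid cells, the algorithm repeatedly removes the lexicographically smallest grade $(x,y)$ from $Q$ and handles it exactly as in the corresponding LW version (scanning and reducing all columns of grades $(1,y),\dots,(x,y)$ as described there), until $Q$ is empty. The reduction is extended as follows: when, while handling grade $(x,y)$, the reduction of column $i$ ends with column $i$ non-zero, with pivot $j$, and $\rho(j)=k$ is already defined with $k>i$, then (besides setting $\rho(j):=i$) let $y'\ge y$ be the $y$-coordinate of the grade of column $k$; if $y'>y$, insert $(x,y')$ into $Q$. *)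

(* Defs.v *)
From mathcomp Require Import all_boot all_order all_algebra.

Set Implicit Arguments.
Unset Strict Implicit.
Unset Printing Implicit Defensive.

Import Order.TTheory GRing.Theory Num.Theory.
Local Open Scope ring_scope.

Definition grade := (int * int)%type.

Definition grade_le (g h : grade) : bool := ((g : int *p int) <= (h : int *p int))%O.
Definition lex_le (g h : grade) : bool := ((g : int *l int) <= (h : int *l int))%O.
Definition colex_le (g h : grade) : bool := lex_le (g.2, g.1) (h.2, h.1).

Definition in_grid (X Y : nat) (g : grade) : bool :=
  (1 <= g.1 <= X%:Z) && (1 <= g.2 <= Y%:Z).

Record gradedMatrix (X Y m n : nat) := GradedMatrix {
  gmx : 'M['F_2]_(m, n);
  rgrade : 'I_m -> grade;
  cgrade : 'I_n -> grade;
  gmx_graded : forall i j, gmx i j = 1 -> grade_le (rgrade i) (cgrade j);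
  rgrade_colex : forall i i' : 'I_m, (i <= i')%N -> colex_le (rgrade i) (rgrade i');
  cgrade_colex : forall j j' : 'I_n, (j <= j')%N -> colex_le (cgrade j) (cgrade j');
  rgrade_grid : forall i, in_grid X Y (rgrade i);
  cgrade_grid : forall j, in_grid X Y (cgrade j)
}.

Definition pivot (m : nat) (v : 'cV['F_2]_m) : option 'I_m :=
  [pick j | (v j 0 != 0) && [forall k, (v k 0 != 0) ==> (k <= j)%N]].

Definition add_col (p n : nat) (k i : 'I_n) (A : 'M['F_2]_(p, n)) : 'M['F_2]_(p, n) :=
  \matrix_(r, c) (if c == i then A r i + A r k else A r c).

(* One type of states serves all four algorithms. [Min_gens] never reads [auxs]
   and the LW versions never read or write [queue]. The output columns have
   length [m] for [Min_gens] and [n] for [Ker_basis]; this length is [p]. *)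
Record state (m n p : nat) := State {
  cols : 'M['F_2]_(m, n);
  auxs : 'M['F_2]_n;
  rho : {ffun 'I_m -> option 'I_n};
  queue : seq grade;
  output : seq ('cV['F_2]_p * grade)
}.

(* The priority queue is a duplicate-free, lexicographically sorted list. *)
Definition queue_of (s : seq grade) : seq grade := sort lex_le (undup s).

Section State.
Variables m n p : nat.
Implicit Types s t u : state m n p.

Definition cur s (i : 'I_n) : 'cV['F_2]_m := col i (cols s).
Definition aux s (i : 'I_n) : 'cV['F_2]_n := col i (auxs s).

Definition add_column (k i : 'I_n) s : state m n p :=
  State (add_col k i (cols s)) (add_col k i (auxs s)) (rho s) (queue s) (output s).

Definition set_rho (j : 'I_m) (i : 'I_n) s : state m n p :=
  State (cols s) (auxs s) [ffun j' => if j' == j then Some i else rho s j']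
    (queue s) (output s).

Definition set_queue (Q : seq grade) s : state m n p :=
  State (cols s) (auxs s) (rho s) Q (output s).

Definition insert (g : grade) s : state m n p := set_queue (queue_of (g :: queue s)) s.

Definition emit (v : 'cV['F_2]_p) (g : grade) s : state m n p :=
  State (cols s) (auxs s) (rho s) (queue s) (rcons (output s) (v, g)).

(* [Some (rho j)] when column [i] is non-zero with pivot [j], and [rho j] is
   defined and less than [i]; [None] when the reduction loop stops. *)
Definition reducer s (i : 'I_n) : option 'I_n :=
  if pivot (cur s i) is Some j then
    if rho s j is Some k then if (k < i)%N then Some k else None else None
  else None.

Definition record_pivot (i : 'I_n) s : state m n p :=
  if pivot (cur s i) is Some j then set_rho j i s else s.

Definition record_pivot_queue (cg : 'I_n -> grade) (g : grade) (i : 'I_n) s : state m n p :=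
  if pivot (cur s i) is Some j then
    set_rho j i
      (if rho s j is Some k then
         if (i < k)%N && (g.2 < (cg k).2) then insert (g.1, (cg k).2) s else s
       else s)
  else s.

End State.

(* A program is given by its big-step semantics: [c s t] says that running [c]
   from state [s] terminates in state [t]. Relations are used since the two
   unbounded loops below are not structurally recursive. *)
Section Programs.
Variables m n p : nat.
Notation st := (state m n p).
Notation program := (st -> st -> Prop).

Definition seq_prog (c d : program) : program := fun s t => exists2 u, c s u & d u t.

Fixpoint for_each (A : Type) (c : A -> program) (l : seq A) : program :=
  if l is a :: l' then seq_prog (c a) (for_each c l') else fun s t => t = s.

Inductive reduce_loop (i : 'I_n) : program :=
| ReduceStop s : reducer s i = None -> reduce_loop i s s
| ReduceStep s k t : reducer s i = Some k ->
    reduce_loop i (add_column k i s) t -> reduce_loop i s t.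

Inductive queue_loop (handle : grade -> program) : program :=
| QueueEmpty s : queue s = [::] -> queue_loop handle s s
| QueuePop s g Q u t : queue s = g :: Q -> handle g (set_queue Q s) u ->
    queue_loop handle u t -> queue_loop handle s t.

(* The first argument is the grade being handled, which the LW reduction ignores. *)
Definition reduce_lw (g : grade) (i : 'I_n) : program :=
  seq_prog (reduce_loop i) (fun s t => t = record_pivot i s).

Definition reduce_gq (cg : 'I_n -> grade) (g : grade) (i : 'I_n) : program :=
  seq_prog (reduce_loop i) (fun s t => t = record_pivot_queue cg g i s).

End Programs.

Definition min_gens_cell (m n : nat) (cg : 'I_n -> grade)
    (reduce : grade -> 'I_n -> state m n m -> state m n m -> Prop) (g : grade)
    : state m n m -> state m n m -> Prop :=
  seq_prog
    (for_each (reduce g) [seq i <- enum 'I_n | ((cg i).2 == g.2) && (1 <= (cg i).1 < g.1)])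
    (for_each
       (fun i => seq_prog (reduce g i)
          (fun s t => t = if cur s i != 0 then emit (cur s i) g s else s))
       [seq i <- enum 'I_n | cg i == g]).

Definition ker_basis_cell (m n : nat) (cg : 'I_n -> grade)
    (reduce : grade -> 'I_n -> state m n n -> state m n n -> Prop) (g : grade)
    : state m n n -> state m n n -> Prop :=
  for_each
    (fun i s t => exists2 u, reduce g i s u &
       t = if (cur s i != 0) && (cur u i == 0) then emit (aux u i) g u else u)
    [seq i <- enum 'I_n | ((cg i).2 == g.2) && (1 <= (cg i).1 <= g.1)].

(* The grid in lexicographic order. *)
Definition grid (X Y : nat) : seq grade :=
  [seq (x%:Z, y%:Z) | x <- iota 1 X, y <- iota 1 Y].

Definition init (X Y m n p : nat) (M : gradedMatrix X Y m n) (Q : seq grade) : state m n p :=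
  State (gmx M) 1%:M [ffun => None] Q [::].

Definition column_grades (X Y m n : nat) (M : gradedMatrix X Y m n) : seq grade :=
  [seq cgrade M i | i <- enum 'I_n].

(* [alg M o] says that the algorithm [alg] terminates on [M] with output [o]. *)
Definition min_gens_lw (X Y m n : nat) (M : gradedMatrix X Y m n)
    (o : seq ('cV['F_2]_m * grade)) : Prop :=
  exists2 s, for_each (min_gens_cell (cgrade M) (@reduce_lw m n m)) (grid X Y)
               (init m M [::]) s
           & output s = o.

Definition min_gens_gq (X Y m n : nat) (M : gradedMatrix X Y m n)
    (o : seq ('cV['F_2]_m * grade)) : Prop :=
  exists2 s, queue_loop (min_gens_cell (cgrade M) (reduce_gq (cgrade M)))
               (init m M (queue_of (column_grades M))) s
           & output s = o.

Definition ker_basis_lw (X Y m n : nat) (M : gradedMatrix X Y m n)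
    (o : seq ('cV['F_2]_n * grade)) : Prop :=
  exists2 s, for_each (ker_basis_cell (cgrade M) (@reduce_lw m n n)) (grid X Y)
               (init n M [::]) s
           & output s = o.

Definition ker_basis_gq (X Y m n : nat) (M : gradedMatrix X Y m n)
    (o : seq ('cV['F_2]_n * grade)) : Prop :=
  exists2 s, queue_loop (ker_basis_cell (cgrade M) (reduce_gq (cgrade M)))
               (init n M (queue_of (column_grades M))) s
           & output s = o.

(* Both algorithms terminate, with one and the same output. *)
Definition same_output (T : Type) (alg alg' : T -> Prop) : Prop :=
  exists o, (forall o', alg o' <-> o' = o) /\ (forall o', alg' o' <-> o' = o).

(* Main.v *)
Require Import Defs.
From mathcomp Require Import all_boot all_order all_algebra.
From mathcomp Require Import zify.

Set Implicit Arguments.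
Unset Strict Implicit.
Unset Printing Implicit Defensive.

Import Order.TTheory GRing.Theory Num.Theory.
Local Open Scope ring_scope.

(** The queue only skips cells on which the grid traversal does nothing. Call a
column settled if it is zero or is the column that [rho] assigns to its own
pivot; reducing a settled column changes nothing. A column loses this property
only when [rho] at its pivot is overwritten by a column of smaller index, hence,
while [(x, y)] is handled, of no larger [y]-coordinate: either it is still to be
reduced in the same cell, or [(x, y')] enters the queue. So, at the start of cell [(x, y)], every
unsettled column of grade [(a, b)] has a grade [(x', b)] with
[x' <= max x a] in the queue. As the grades in the queue are lexicographically
at least [(x, y)], all columns concerned by a cell outside the queue are settled. *)

(** * Lexicographic order, the queue and the grid *)

Lemma lex_leE (g h : grade) :
  lex_le g h = (g.1 < h.1) || ((g.1 == h.1) && (g.2 <= h.2)).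
Proof. by rewrite /lex_le Order.ProdLexiOrder.leEprodlexi /=; lia. Qed.

Lemma lex_le_refl : reflexive lex_le.
Proof. by move=> g; exact: lexx. Qed.

Lemma lex_le_trans : transitive lex_le.
Proof. by move=> g h k; exact: le_trans. Qed.

Lemma lex_le_anti : antisymmetric lex_le.
Proof. by move=> g h; exact: le_anti. Qed.

Lemma lex_le_total : total lex_le.
Proof. by move=> g h; exact: le_total. Qed.

Lemma mem_queue_of (Q : seq grade) : queue_of Q =i Q.
Proof. by move=> g; rewrite mem_sort mem_undup. Qed.

Lemma queue_of_sorted (Q : seq grade) : sorted lex_le (queue_of Q).
Proof. exact: sort_sorted lex_le_total _. Qed.

Lemma queue_of_uniq (Q : seq grade) : uniq (queue_of Q).
Proof. by rewrite sort_uniq undup_uniq. Qed.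

Lemma mem_grid (X Y : nat) (g : grade) : (g \in grid X Y) = in_grid X Y g.
Proof.
apply/allpairsP/idP => [[[x y] /= [+ + ->]]|].
  by rewrite !mem_iota /in_grid /=; lia.
case: g => -[x|x] [y|y]; rewrite /in_grid /= => gXY; try lia.
by exists (x, y); rewrite !mem_iota; split=> //=; lia.
Qed.

Lemma grid_sorted (X Y : nat) : sorted lex_le (grid X Y).
Proof.
rewrite sorted_pairwise; last exact: lex_le_trans.
rewrite /grid; have := iota_ltn_sorted 1 Y; move: (iota 1 Y) => ys ys_sorted.
elim: X 1%N => //= X IH x.
rewrite pairwise_cat IH andbT; apply/andP; split.
  apply/allrelP => _ _ /mapP[y _ ->] /allpairsP[[x' y'] /= [+ _ ->]].
  by rewrite mem_iota lex_leE /=; lia.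
rewrite pairwise_map; move: ys_sorted.
rewrite (sorted_pairwise ltn_trans); apply: sub_pairwise => y y' /=.
by rewrite lex_leE /=; lia.
Qed.

Lemma grid_uniq (X Y : nat) : uniq (grid X Y).
Proof.
apply: allpairs_uniq; rewrite ?iota_uniq //.
by move=> [x y] [x' y'] _ _ /= [-> ->].
Qed.

(** * Pivots over the field with two elements *)

Lemma pivotP (m : nat) (v : 'cV['F_2]_m) (j : 'I_m) :
  pivot v = Some j <-> v j 0 != 0 /\ forall k, v k 0 != 0 -> (k <= j)%N.
Proof.
rewrite /pivot; split.
  by case: pickP => // i /andP[vj /forallP le_j] [<-]; split=> // k; exact/implyP.
case=> vj le_j; case: pickP => [k /andP[vk /forallP le_k]|/(_ j)].
  congr Some; apply/val_inj/eqP.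
  by rewrite eqn_leq le_j //; move/implyP: (le_k j); apply.
by rewrite vj /= => /forallP[]; move=> k; apply/implyP/le_j.
Qed.

Lemma F2_addr_eq0 (a b : 'F_2) : a != 0 -> b != 0 -> a + b = 0.
Proof.
by case: a => -[|[|//]] // ?; case: b => -[|[|//]] // ? _ _; apply/val_inj.
Qed.

(** The two entries in row [j] are both [1] and cancel, and both columns vanish in all rows of
    larger index. This drop of the pivot makes the reduction loop terminate. *)
Lemma pivot_add (m : nat) (v w : 'cV['F_2]_m) (j j' : 'I_m) :
  pivot v = Some j -> pivot w = Some j -> pivot (v + w) = Some j' -> (j' < j)%N.
Proof.
move=> /pivotP[vj le_v] /pivotP[wj le_w] /pivotP[]; rewrite mxE => vwj' _.
rewrite ltn_neqAle; apply/andP; split.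
  apply: contraNneq vwj' => /val_inj ->.
  by rewrite F2_addr_eq0.
have [vj'0|/le_v //] := eqVneq (v j' 0) 0.
by apply: le_w; move: vwj'; rewrite vj'0 add0r.
Qed.

(** * Determinism of the programs *)

Definition functional (T : Type) (c : T -> T -> Prop) : Prop :=
  forall s t t', c s t -> c s t' -> t = t'.

Section Functional.
Variables m n p : nat.
Notation st := (state m n p).

Lemma seq_prog_functional (c d : st -> st -> Prop) :
  functional c -> functional d -> functional (seq_prog c d).
Proof.
move=> fc fd s t t' [u csu dut] [u' csu' dut'].
by rewrite (fc _ _ _ csu csu') in dut; exact: fd dut dut'.
Qed.

Lemma for_each_functional (A : Type) (c : A -> st -> st -> Prop) (l : seq A) :
  (forall a, functional (c a)) -> functional (for_each c l).
Proof.
move=> fc; elim: l => [|a l IH] /=; first by move=> s t t' -> ->.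
exact: seq_prog_functional.
Qed.

Lemma reduce_loop_functional (i : 'I_n) : functional (@reduce_loop m n p i).
Proof.
move=> s t t' st; elim: st t' => {s t} [s rs|s k t rs _ IH] t' st'.
  by inversion st' as [|s' k' u rs']; subst => //; rewrite rs in rs'.
inversion st' as [s' rs'|s' k' u rs' kst']; subst; rewrite rs in rs' => //.
by case: rs' kst' => <-; exact: IH.
Qed.

Lemma reduce_lw_functional (g : grade) (i : 'I_n) :
  functional (@reduce_lw m n p g i).
Proof.
apply: seq_prog_functional; first exact: reduce_loop_functional.
by move=> s t t' -> ->.
Qed.

Lemma reduce_gq_functional (cg : 'I_n -> grade) (g : grade) (i : 'I_n) :
  functional (@reduce_gq m n p cg g i).
Proof.
apply: seq_prog_functional; first exact: reduce_loop_functional.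
by move=> s t t' -> ->.
Qed.

Lemma queue_loop_functional (handle : grade -> st -> st -> Prop) :
  (forall g, functional (handle g)) -> functional (queue_loop handle).
Proof.
move=> fh s t t' st; elim: st t' => {s t} [s Qs|s g Q u t Qs hu _ IH] t' st'.
  by inversion st' as [|s' g Q u t'' Qs']; subst => //; rewrite Qs in Qs'.
inversion st' as [s' Qs'|s' g' Q' u' t'' Qs' hu' ut']; subst; rewrite Qs in Qs' => //.
case: Qs' hu' => <- <- hu'; apply: IH.
by rewrite (fh _ _ _ _ hu hu').
Qed.

End Functional.

(** * The invariants and their behaviour under one reduction *)

Section Simulation.
Variables m n p : nat.
Variable cg : 'I_n -> grade.
Hypothesis cg_colex : forall j j' : 'I_n, (j <= j')%N -> colex_le (cg j) (cg j').
Notation st := (state m n p).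
Implicit Types (s t u : st) (g h c : grade) (x : int) (i k : 'I_n).

(** Here [x] is the first coordinate of the current cell. The bound guarantees that a column
    displaced from [rho] belongs to the current cell as soon as it has the [y]-coordinate of that
    cell. *)
Definition rho_ok x s : Prop := forall j k,
  rho s j = Some k -> pivot (cur s k) = Some j /\ (cg k).1 <= x.

Definition settled s k : bool :=
  if pivot (cur s k) is Some j then rho s j == Some k else true.

Definition covered (Q : seq grade) x k : Prop :=
  exists2 g : grade, g \in Q & g.2 = (cg k).2 /\ g.1 <= Num.max x (cg k).1.

Lemma rho_ok_mono x x' s : x <= x' -> rho_ok x s -> rho_ok x' s.
Proof.
by move=> le_xx' ok j k /ok[-> le_kx]; split=> //; exact: le_trans le_xx'.
Qed.

Lemma covered_mono Q Q' x x' k :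
  {subset Q <= Q'} -> x <= x' -> covered Q x k -> covered Q' x' k.
Proof. by move=> QQ' ? [g /QQ' ? [? ?]]; exists g => //; split=> //; lia. Qed.

Lemma settled_reducer s i : settled s i -> reducer s i = None.
Proof.
rewrite /settled /reducer; case: (pivot _) => // j /eqP ->.
by rewrite ltnn.
Qed.

Lemma settled_record_pivot s i : settled s i -> record_pivot i s = s.
Proof.
rewrite /settled /record_pivot; case: (pivot _) => // j /eqP rs.
case: s rs => C A r Q o /= rs; congr State; apply/ffunP => j'.
by rewrite ffunE; case: eqP => // ->.
Qed.

Lemma settled_reduce_lw g s i : settled s i -> reduce_lw g i s s.
Proof.
move=> si; exists s; last by rewrite settled_record_pivot.
by apply: ReduceStop; exact: settled_reducer.
Qed.

Lemma cur_add_column k i i' s :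
  cur (add_column k i s) i' = if i' == i then cur s i + cur s k else cur s i'.
Proof.
by apply/colP => r; rewrite !mxE; case: ifP => _; rewrite !mxE.
Qed.

(* Column [i] is only modified when [rho] sends its pivot elsewhere, so no
   value of [rho] is [i] at that moment. *)
Lemma rho_ok_add_column x k i s :
  reducer s i = Some k -> rho_ok x s -> rho_ok x (add_column k i s).
Proof.
rewrite /reducer; case pi: (pivot _) => [j|//].
case rj: (rho s j) => [k'|//]; case: ltnP => // lt_k'i [<-] ok j' k'' rj'.
have [pk'' le_x] := ok _ _ rj'; rewrite cur_add_column; split=> //.
case: eqP => // ik''; move: pk'' rj'; rewrite ik'' pi => -[<-].
by rewrite rj => -[ik']; rewrite ik' ltnn in lt_k'i.
Qed.

(** By [rho_ok] the added column has the same pivot as column [i], so each addition strictly lowers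
    that pivot; the induction is on a strict bound for it. *)
Lemma reduce_loop_total x i s : rho_ok x s ->
  exists t, [/\ reduce_loop i s t, reducer t i = None, rho_ok x t
    & [/\ rho t = rho s, queue t = queue s
        & forall k, k != i -> cur t k = cur s k]].
Proof.
pose bounded N s := forall j, pivot (cur s i) = Some j -> (j < N)%N.
move=> ok; have [N bs] : exists N, bounded N s by exists m => j _; exact: ltn_ord.
elim: N s bs ok => [|N IH] s bs ok; case rs: (reducer s i) => [k|];
  try by exists s; split=> //; exact: ReduceStop.
  (* With bound [0] column [i] has no pivot, so it cannot have a reducer. *)
  by move: rs; rewrite /reducer; case pi: (pivot _) => [j|//]; move/bs: pi.
have [|t [st rt okt [rhot Qt curt]]] := IH _ _ (rho_ok_add_column rs ok).
  move=> j'; rewrite cur_add_column eqxx.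
  move: (rs); rewrite /reducer; case pi: (pivot _) => [j|//].
  case rj: (rho s j) => [k'|//]; case: ltnP => // _ [k'k].
  have [pk _] := ok _ _ rj; rewrite -k'k => /(pivot_add pi pk) lt_j'j.
  exact: leq_trans lt_j'j (bs _ pi).
exists t; split=> //; first exact: ReduceStep rs st.
split=> // k' k'i; rewrite curt // cur_add_column.
by rewrite (negbTE k'i).
Qed.

Lemma reduce_loop_set_queue i Q s t :
  reduce_loop i s t -> reduce_loop i (set_queue Q s) (set_queue Q t).
Proof.
elim=> {s t} [s rs|s k t rs _ IH]; first exact: ReduceStop.
exact: (@ReduceStep _ _ _ i (set_queue Q s) k).
Qed.

(** The two versions are compared by erasing the queue: insertions are the only difference between
    their reductions, and erasure hides them. *)
Lemma record_pivot_erase g i s :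
  record_pivot i (set_queue [::] s) =
  set_queue [::] (record_pivot_queue cg g i s).
Proof.
rewrite /record_pivot /record_pivot_queue /=.
case: (pivot _) => // j; rewrite /set_rho /set_queue /=.
by case: (rho s j) => // k; case: ifP.
Qed.

(** Sortedness makes the head the lexicographic minimum; uniqueness ensures that a popped grade is
    really gone. *)
Definition queue_ok s : bool := sorted lex_le (queue s) && uniq (queue s).

(* The grades that may be inserted while handling [g]. *)
Definition queue_ext g (Q Q' : seq grade) : Prop :=
  {subset Q <= Q'} /\
  forall h, h \in Q' -> h \in Q \/ exists2 k, h = (g.1, (cg k).2) & g.2 < (cg k).2.

Lemma queue_ext_refl g Q : queue_ext g Q Q.
Proof. by split=> // h; left. Qed.

Lemma queue_ext_trans g Q1 Q2 Q3 :
  queue_ext g Q1 Q2 -> queue_ext g Q2 Q3 -> queue_ext g Q1 Q3.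
Proof.
move=> [s12 e12] [s23 e23]; split=> [h /s12/s23 //|h /e23[/e12 //|]].
by right.
Qed.

(** Only the column [k] displaced from [rho] at the pivot of [i] can cease to be settled. As the
    loop has stopped, [i < k], so the colex order gives [k] a [y]-coordinate at least [g.2]. If it
    is larger, the inserted grade covers [k]; if equal, [rho_ok] places [k] among the later columns
    of the cell. *)
Lemma record_pivot_queue_spec g i s :
  rho_ok g.1 s -> queue_ok s -> reducer s i = None ->
  (cg i).1 <= g.1 -> (cg i).2 = g.2 ->
  let t := record_pivot_queue cg g i s in
  [/\ rho_ok g.1 t, queue_ok t, queue_ext g (queue s) (queue t), settled t i
    & forall k, k != i -> settled s k ->
        [\/ settled t k, covered (queue t) g.1 k
          | [/\ (i < k)%N, (cg k).1 <= g.1 & (cg k).2 = g.2]]].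
Proof.
move=> ok okQ rs cgi1 cgi2; rewrite /record_pivot_queue.
case pi: (pivot (cur s i)) => [j|]; last first.
  split=> //; [exact: queue_ext_refl | by rewrite /settled pi |].
  by move=> k _ sk; constructor 1.
set s' := (X in set_rho j i X); set t := set_rho j i s'.
have [curt rhot Qt] : [/\ forall k, cur t k = cur s k,
    forall j', rho t j' = (if j' == j then Some i else rho s j')
    & queue t = queue s'].
  rewrite /t /s'; case: (rho s j) => [k|]; [case: ifP => _|]; split=> //;
  by move=> j'; rewrite ffunE.
have okt : rho_ok g.1 t.
  move=> j' k; rewrite rhot curt; case: eqP => [-> [<-]|_ /ok //].
  by [].
have sti : settled t i by rewrite /settled curt pi rhot eqxx.
have Qs' : queue_ok s' /\ queue_ext g (queue s) (queue s').
  rewrite /s'; case: (rho s j) => [k|]; last by split=> //; exact: queue_ext_refl.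
  case: ifP => [/andP[_ ltgk]|_]; last by split=> //; exact: queue_ext_refl.
  split; first by rewrite /queue_ok queue_of_sorted queue_of_uniq.
  split=> h; rewrite mem_queue_of inE; first by move=> ->; rewrite orbT.
  by case/predU1P => [->|]; [right; exists k | left].
case: Qs' => okQ' ext; split=> //; rewrite ?/queue_ok ?Qt //.
move=> k ki; rewrite /settled curt; case pk: (pivot _) => [jk|]; last by constructor 1.
rewrite rhot; have [->|_] := eqVneq jk j; last by move=> ?; constructor 1.
move=> /eqP rj; move: rs; rewrite /reducer pi rj; case: ltnP => // le_ik _.
have lt_ik : (i < k)%N by rewrite ltn_neqAle le_ik andbT; apply: contraNneq ki => /val_inj ->.
have := cg_colex le_ik; rewrite /colex_le lex_leE /= => cgik.
have [_ cgk1] := ok _ _ rj.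
have [ltgk|legk] := ltP g.2 (cg k).2; last by constructor 3; split=> //; lia.
constructor 2; exists (g.1, (cg k).2); last by split=> //=; lia.
by rewrite /s' rj lt_ik ltgk /= mem_queue_of mem_head.
Qed.

Lemma reduce_gq_spec g i s :
  rho_ok g.1 s -> queue_ok s -> (cg i).1 <= g.1 -> (cg i).2 = g.2 ->
  exists t, [/\ reduce_gq cg g i s t,
    reduce_lw g i (set_queue [::] s) (set_queue [::] t) &
  [/\ rho_ok g.1 t, queue_ok t, queue_ext g (queue s) (queue t), settled t i
    & forall k, k != i -> settled s k ->
        [\/ settled t k, covered (queue t) g.1 k
          | [/\ (i < k)%N, (cg k).1 <= g.1 & (cg k).2 = g.2]]]].
Proof.
move=> ok okQ cgi1 cgi2.
have [u [su ru oku [rhou Qu curu]]] := reduce_loop_total i ok.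
have okQu : queue_ok u by rewrite /queue_ok Qu.
have [okt okQt ext sti keep] := record_pivot_queue_spec oku okQu ru cgi1 cgi2.
exists (record_pivot_queue cg g i u); split; first by exists u.
  exists (set_queue [::] u); first exact: reduce_loop_set_queue.
  by rewrite (record_pivot_erase g).
rewrite -Qu; split=> // k ki sk; apply: keep => //.
by rewrite /settled rhou curu.
Qed.

(* [post g i s u] is the emission that follows the reduction of column [i] from
   state [s] to state [u]. *)
Variable post : grade -> 'I_n -> st -> st -> st.
Hypothesis post_set_queue : forall g i Q s u,
  post g i (set_queue Q s) (set_queue Q u) = set_queue Q (post g i s u).
Hypothesis post_frame : forall g i s u,
  exists o, post g i s u = State (cols u) (auxs u) (rho u) (queue u) o.
(** This is asked only off grade [g] because Min_gens emits a non-zero column of grade [g] even when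
    its reduction changes nothing. *)
Hypothesis post_id : forall g i s, cg i != g -> post g i s s = s.

Variable members : grade -> seq 'I_n.
Hypothesis members_sorted : forall g, sorted ltn (map val (members g)).
Hypothesis mem_members : forall g i,
  (i \in members g) = ((cg i).2 == g.2) && ((cg i).1 <= g.1).

(** * Reduction of all columns of one cell *)

Definition step (reduce : grade -> 'I_n -> st -> st -> Prop) g i s t : Prop :=
  exists2 u, reduce g i s u & t = post g i s u.

Definition cell (reduce : grade -> 'I_n -> st -> st -> Prop) g : st -> st -> Prop :=
  for_each (step reduce g) (members g).

Lemma step_spec g i s :
  rho_ok g.1 s -> queue_ok s -> (cg i).1 <= g.1 -> (cg i).2 = g.2 ->
  exists t, [/\ step (reduce_gq cg) g i s t,
    step (@reduce_lw m n p) g i (set_queue [::] s) (set_queue [::] t) &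
  [/\ rho_ok g.1 t, queue_ok t, queue_ext g (queue s) (queue t), settled t i
    & forall k, k != i -> settled s k ->
        [\/ settled t k, covered (queue t) g.1 k
          | [/\ (i < k)%N, (cg k).1 <= g.1 & (cg k).2 = g.2]]]].
Proof.
move=> ok okQ cgi1 cgi2.
have [u [su su' specu]] := reduce_gq_spec ok okQ cgi1 cgi2.
exists (post g i s u); split; first by exists u.
  by exists (set_queue [::] u); rewrite ?post_set_queue.
by have [o ->] := post_frame g i s u.
Qed.

(* The columns of [members g] not in [l] have already been handled. *)
Lemma for_each_step_spec g (l : seq 'I_n) s :
  sorted ltn (map val l) -> {subset l <= members g} ->
  (forall k, k \in members g -> k \in l \/ {in l, forall i, (k < i)%N}) ->
  rho_ok g.1 s -> queue_ok s ->
  (forall k, [\/ settled s k, covered (queue s) g.1 k | k \in l]) ->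
  exists t, [/\ for_each (step (reduce_gq cg) g) l s t,
    for_each (step (@reduce_lw m n p) g) l (set_queue [::] s) (set_queue [::] t) &
  [/\ rho_ok g.1 t, queue_ok t, queue_ext g (queue s) (queue t)
    & forall k, settled t k \/ covered (queue t) g.1 k]].
Proof.
elim: l s => [|i l IH] s srt sub handled ok okQ inv.
  exists s; split=> //; split=> //; first exact: queue_ext_refl.
  by move=> k; case: (inv k) => // ?; [left|right].
have := sub i (mem_head _ _); rewrite mem_members => /andP[/eqP cgi2 cgi1].
have lt_il : {in l, forall k, (i < k)%N}.
  move=> k kl; move: srt; rewrite /= (path_sortedE ltn_trans) => /andP[/allP lt_il _].
  by apply: lt_il; exact: map_f.
have [u [su su' [oku okQu ext sui keep]]] := step_spec ok okQ cgi1 cgi2.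
have [|||//|//||t [ut ut' [okt okQt ext' invt]]] := IH u.
- exact: path_sorted srt.
- by move=> k kl; apply: sub; rewrite inE kl orbT.
- move=> k /handled[|lt_k]; last by right=> k' k'l; apply: lt_k; rewrite inE k'l orbT.
  by rewrite inE => /predU1P[->|]; [right | left].
- move=> k; have [->|ki] := eqVneq k i; first by constructor 1.
  case: (inv k) => [|cov|].
  + case/(keep _ ki) => [?|?|[lt_ik cgk1 cgk2]]; [by constructor 1|by constructor 2|].
    (* A column of this cell displaced by [i] has an index larger than [i], so it has not been
       handled yet and still lies in [l]. *)
    constructor 3; have /handled : k \in members g by rewrite mem_members cgk2 eqxx.
    rewrite inE (negbTE ki) => -[//|/(_ i (mem_head _ _))].
    by rewrite ltnNge (ltnW lt_ik).
  + by constructor 2; apply: covered_mono cov => //; case: ext.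
  + by rewrite inE (negbTE ki) => ?; constructor 3.
exists t; split; [by exists u|by exists (set_queue [::] u)|].
by split=> //; exact: queue_ext_trans ext'.
Qed.

(** This is what the LW version does in a cell that the queue skips. *)
Lemma for_each_step_settled g (l : seq 'I_n) s :
  {in l, forall i, settled s i && (cg i != g)} ->
  for_each (step (@reduce_lw m n p) g) l s s.
Proof.
elim: l => //= i l IH sl; have /andP[si cgi] := sl i (mem_head _ _).
exists s; last by apply: IH => k kl; apply: sl; rewrite inE kl orbT.
by exists s; [exact: settled_reduce_lw | rewrite post_id].
Qed.

(** * Simulation of whole runs *)

Variables X Y : nat.
Hypothesis cg_grid : forall i, in_grid X Y (cg i).

(** Induction on [L], the final segment of the grid still to be traversed. If its first cell is in
    the queue, it is the head and both versions handle it alike; otherwise the LW version passes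
    over it without effect. The invariant is stated for every cell of [L], being monotone in the
    first coordinate, so that an empty [L] needs no special case. *)
Lemma simulation (L : seq grade) s :
  sorted lex_le L -> uniq L -> all (in_grid X Y) L ->
  (forall c h, c \in L -> in_grid X Y h -> lex_le c h -> h \in L) ->
  queue_ok s -> {subset queue s <= L} ->
  (forall k, cg k \in L -> cg k \in queue s) ->
  {in L, forall c, rho_ok c.1 s /\
     forall k, settled s k \/ covered (queue s) c.1 k} ->
  exists t, queue_loop (cell (reduce_gq cg)) s t /\
    for_each (cell (@reduce_lw m n p)) L (set_queue [::] s) (set_queue [::] t).
Proof.
elim: L s => [|c L IH] s srt unq gridL up okQ QL cgQ inv.
  exists s; split=> //; apply: QueueEmpty.
  by case: (queue s) QL => // g Q /(_ g (mem_head _ _)).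
have [ok invc] := inv c (mem_head _ _).
have /andP[cL unqL] : (c \notin L) && uniq L by [].
have /andP[gridc gridL'] : in_grid X Y c && all (in_grid X Y) L by [].
have srtL : sorted lex_le L := path_sorted srt.
have leL : {in L, forall h, lex_le c h}.
  by move: srt; rewrite /= (path_sortedE lex_le_trans) => /andP[/allP].
have upL c' h : c' \in L -> in_grid X Y h -> lex_le c' h -> h \in L.
  move=> c'L gh le_c'h; have := up c' h; rewrite !inE c'L orbT => /(_ isT gh le_c'h).
  case/predU1P => // hc; case/negP: cL; rewrite -hc in leL *.
  by rewrite (@lex_le_anti h c') // leL.
have gt_mem h : in_grid X Y h -> lex_le c h -> h != c -> h \in L.
  by move=> gh /(up c h (mem_head _ _) gh); rewrite inE => /predU1P[->|//]; rewrite eqxx.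
case/andP: (okQ) => srtQ unqQ.
have [cQ|cQ] := boolP (c \in queue s); last first.
  have QL' : {subset queue s <= L}.
    by move=> h hQ; have := QL h hQ; rewrite inE => /predU1P[hc|//]; rewrite -hc hQ in cQ.
  have [|c' c'L|t [st st']] := IH s srtL unqL gridL' upL okQ QL'.
  - by move=> k kL; apply: cgQ; rewrite inE kL orbT.
  - by apply: inv; rewrite inE c'L orbT.
  exists t; split=> //; exists (set_queue [::] s) => //.
  apply: for_each_step_settled => k; rewrite mem_members => /andP[/eqP cgk2 cgk1].
  apply/andP; split; last first.
    (* A column of grade [c] would keep [c] in the queue. *)
    by apply: contraNneq cQ => cgk; rewrite -{1}cgk cgQ // cgk mem_head.
  (* A grade covering a column of this cell has second coordinate [c.2] and first coordinate at most
     [c.1], so it is lexicographically at most [c]. Lying in the queue, hence in [L], it is also at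
     least [c], so it equals [c], which is not in the queue. *)
  case: (invc k) => // -[g gQ [g2 g1]]; case/negP: cQ.
  suff <- : g = c by [].
  apply: lex_le_anti; rewrite (leL _ (QL' g gQ)) lex_leE g2 cgk2 lexx !andbT.
  by rewrite orbC -le_eqVlt -(max_l cgk1) g1.
case Qs: (queue s) cQ => [//|q Q] cQ.
have qc : q = c.
  apply: lex_le_anti; apply/andP; split; last first.
    have := QL q; rewrite Qs mem_head inE => /(_ isT) /predU1P[->|/leL //].
    exact: lex_le_refl.
  move: srtQ; rewrite Qs /= (path_sortedE lex_le_trans) => /andP[/allP le_q _].
  by move: cQ; rewrite inE => /predU1P[->|/le_q //]; exact: lex_le_refl.
rewrite {q}qc in Qs cQ.
have /andP[cQ' unqQ'] : (c \notin Q) && uniq Q by move: unqQ; rewrite Qs.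
have srtQ' : sorted lex_le Q by move: srtQ; rewrite Qs => /path_sorted.
have QL' : {subset Q <= L}.
  move=> h hQ; have := QL h; rewrite Qs !inE hQ orbT => /(_ isT) /predU1P[hc|//].
  by rewrite -hc hQ in cQ'.
have cgQ' k : cg k \in L -> cg k \in Q.
  move=> kL; have := cgQ k; rewrite Qs !inE kL orbT => /(_ isT) /predU1P[kc|//].
  by rewrite -kc kL in cL.
have [||||||t [st st' [okt okQt [QQ' ext] invt]]] :=
  @for_each_step_spec c (members c) (set_queue Q s).
- exact: members_sorted.
- by [].
- by move=> k ?; left.
- exact: ok.
- by rewrite /queue_ok /= srtQ'.
- move=> k; case: (invc k) => [?|[g]]; first by constructor 1.
  rewrite Qs inE => /predU1P[->|gQ] [g2 g1]; last by constructor 2; exists g.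
  (* Popping [c] may remove the grade that covered [k]. Either [k] is reduced in this very cell, or
     it lies further right and its own grade, still queued, covers it; the maximum in [covered]
     allows for the latter. *)
  have [le_kc|lt_ck] := leP (cg k).1 c.1.
    by constructor 3; rewrite mem_members g2 eqxx.
  constructor 2; exists (cg k); last by rewrite le_max lexx orbT.
  apply: cgQ'; apply: gt_mem => //; first by rewrite lex_leE lt_ck.
  by apply: contraTneq lt_ck => ->; rewrite ltxx.
have [|k kL|c' c'L|t' [tt' tt'']] := IH t srtL unqL gridL' upL okQt.
(* An inserted grade has first coordinate [c.1] and the larger second coordinate of some column, so
   it is in the grid and strictly after [c]. *)
- move=> h /ext[/QL' //|[k -> /= lt_ck]].
  apply: gt_mem; last by apply: contraTneq lt_ck => <-; rewrite ltxx.
    by move: gridc (cg_grid k) => /andP[gc _] /andP[_ gk]; rewrite /in_grid gc.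
  by rewrite lex_leE /= eqxx (ltW lt_ck) orbT.
- by apply: QQ'; exact: cgQ'.
- have le_cc' : c.1 <= c'.1 by have := leL c' c'L; rewrite lex_leE => /orP[/ltW|/andP[/eqP->]].
  split=> [|k]; first exact: rho_ok_mono okt.
  by case: (invt k) => [?|cov]; [left | right; exact: covered_mono cov].
exists t'; split; last by exists (set_queue [::] t).
exact: QueuePop Qs st tt'.
Qed.

Lemma simulation_init (C : 'M['F_2]_(m, n)) (A : 'M['F_2]_n) o :
  exists t,
    queue_loop (cell (reduce_gq cg))
      (State C A [ffun => None] (queue_of [seq cg i | i <- enum 'I_n]) o) t /\
    for_each (cell (@reduce_lw m n p)) (grid X Y)
      (State C A [ffun => None] [::] o) (set_queue [::] t).
Proof.
set s := State C A _ (queue_of _) o.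
have cgQ k : cg k \in queue s by rewrite mem_queue_of map_f // mem_enum.
apply: (@simulation (grid X Y) s) => //; rewrite ?grid_sorted ?grid_uniq //.
- by apply/allP => g; rewrite mem_grid.
- by move=> c h _ gh _; rewrite mem_grid.
- by rewrite /queue_ok queue_of_sorted queue_of_uniq.
- by move=> h; rewrite mem_queue_of => /mapP[k _ ->]; rewrite mem_grid.
move=> c _; split=> [j k|k]; first by rewrite ffunE.
(* Initially each column is covered by its own grade. *)
by right; exists (cg k); rewrite // le_max lexx orbT.
Qed.

End Simulation.

(** * From simulated runs to equal outputs *)

Lemma same_output_of_runs (S T : Type) (out : S -> T) (run run' : S -> Prop) s s' :
  run s -> run' s' -> out s = out s' ->
  (forall t t', run t -> run t' -> t = t') ->
  (forall t t', run' t -> run' t' -> t = t') ->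
  same_output (fun o => exists2 t, run t & out t = o)
    (fun o => exists2 t, run' t & out t = o).
Proof.
move=> rs rs' oss' fr fr'; exists (out s); split=> o'; split.
- by case=> t rt <-; rewrite (fr _ _ rs rt).
- by move=> ->; exists s.
- by case=> t rt <-; rewrite oss' (fr' _ _ rs' rt).
- by move=> ->; exists s'.
Qed.

Section Monotonicity.
Variables m n p : nat.
Notation st := (state m n p).

Lemma for_each_mono (A : eqType) (c d : A -> st -> st -> Prop) (l : seq A) s t :
  {in l, forall a s t, c a s t -> d a s t} -> for_each c l s t -> for_each d l s t.
Proof.
elim: l s => //= a l IH s cd [u su ut]; exists u; first by apply: cd; rewrite ?mem_head.
by apply: IH ut => b bl; apply: cd; rewrite inE bl orbT.
Qed.

Lemma for_each_cat (A : Type) (c : A -> st -> st -> Prop) (l l' : seq A) s t :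
  for_each c (l ++ l') s t -> seq_prog (for_each c l) (for_each c l') s t.
Proof.
elim: l s => [|a l IH] s /=; first by exists s.
by case=> u su /IH[v uv vt]; exists v => //; exists u.
Qed.

Lemma queue_loop_mono (c d : grade -> st -> st -> Prop) s t :
  (forall g s t, c g s t -> d g s t) -> queue_loop c s t -> queue_loop d s t.
Proof.
move=> cd; elim=> {s t} [s Qs|s g Q u t Qs /cd su _ ut]; first exact: QueueEmpty.
exact: QueuePop Qs su ut.
Qed.

End Monotonicity.

(** * The two algorithms as instances *)

Section Instances.
Variables X Y m n : nat.
Variable M : gradedMatrix X Y m n.
Notation cg := (cgrade M).

Lemma filter_enum_sorted (P : pred 'I_n) :
  sorted ltn (map val [seq i <- enum 'I_n | P i]).
Proof.
rewrite sorted_map; apply: sorted_filter; first by move=> j i k; exact: ltn_trans.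
by rewrite -(@sorted_map _ _ val ltn) val_enum_ord iota_ltn_sorted.
Qed.

Definition ker_post g i (s u : state m n n) : state m n n :=
  if (cur s i != 0) && (cur u i == 0) then emit (aux u i) g u else u.

Lemma ker_basis_cell_functional
    (reduce : grade -> 'I_n -> state m n n -> state m n n -> Prop) g :
  (forall i, functional (reduce g i)) -> functional (ker_basis_cell cg reduce g).
Proof.
move=> fr; apply: for_each_functional => i s t t' [u su ->] [u' su' ->].
by rewrite (fr _ _ _ _ su su').
Qed.

Lemma ker_basis_same_output : same_output (ker_basis_gq M) (ker_basis_lw M).
Proof.
have [g i Q s u|g i s u|g i s|g|g i|t [st st']] :=
  @simulation_init m n n cg (@cgrade_colex _ _ _ _ M) ker_post _ _ _
    (fun g => [seq i <- enum 'I_n | ((cg i).2 == g.2) && (1 <= (cg i).1 <= g.1)])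
    _ _ X Y (@cgrade_grid _ _ _ _ M) (gmx M) 1%:M [::].
- by rewrite /ker_post; case: ifP.
- by rewrite /ker_post; case: ifP => _; [eexists | exists (output u); case: u].
- by rewrite /ker_post andNb.
- exact: filter_enum_sorted.
- rewrite mem_filter mem_enum andbT; have := cgrade_grid M i.
  by rewrite /in_grid => /andP[/andP[-> _] _].
(* With [ker_post], [cell] is convertible to [ker_basis_cell], and erasing the queue leaves the
   output unchanged. *)
apply: same_output_of_runs st st' _ _ _ => //.
- apply: queue_loop_functional => g; apply: ker_basis_cell_functional => i.
  exact: reduce_gq_functional.
- apply: for_each_functional => g; apply: ker_basis_cell_functional => i.
  exact: reduce_lw_functional.
Qed.


(** The test on the grade tells the two loops of Min_gens apart, so that a single loop over their
    concatenation can represent both. *)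
Definition min_post g i (s u : state m n m) : state m n m :=
  if (cg i == g) && (cur u i != 0) then emit (cur u i) g u else u.

Definition min_members (g : grade) : seq 'I_n :=
  [seq i <- enum 'I_n | ((cg i).2 == g.2) && (1 <= (cg i).1 < g.1)] ++
  [seq i <- enum 'I_n | cg i == g].

(** All these columns share one [y]-coordinate, and those of the second list have the larger
    [x]-coordinate, so the colex order puts them after the first list. *)
Lemma min_members_sorted g : sorted ltn (map val (min_members g)).
Proof.
rewrite (sorted_pairwise ltn_trans) map_cat pairwise_cat -!(sorted_pairwise ltn_trans).
rewrite !filter_enum_sorted !andbT; apply/allrelP => _ _ /mapP[i + ->] /mapP[k + ->].
rewrite !mem_filter => /andP[/and3P[/eqP cgi2 _ lt_i] _] /andP[/eqP cgk _] /=.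
rewrite ltnNge; apply/negP => /(cgrade_colex M); rewrite /colex_le lex_leE /= cgk cgi2.
by rewrite ltxx eqxx leNgt lt_i.
Qed.

Lemma mem_min_members g i :
  (i \in min_members g) = ((cg i).2 == g.2) && ((cg i).1 <= g.1).
Proof.
rewrite mem_cat (mem_filter _ _ (enum _)) (mem_filter _ _ (enum _)) !mem_enum !andbT.
have /andP[/andP[-> _] _] := cgrade_grid M i.
rewrite -pair_eqE /pair_eq le_eqVlt /=.
by case: (_.2 == _); rewrite ?andbF //= andbT orbC.
Qed.

(** One inclusion suffices: it transfers the simulated runs, and determinism of [min_gens_cell]
    excludes any others. *)
Lemma min_gens_cellP reduce g s t :
  cell min_post min_members reduce g s t -> min_gens_cell cg reduce g s t.
Proof.
case/for_each_cat => u su ut; exists u.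
  apply: for_each_mono su => i; rewrite mem_filter => /andP[/and3P[_ _ lt_i] _].
  move=> s1 t1 [u1 su1 ->]; rewrite /min_post.
  by have [cgi|_] := eqVneq (cg i) g; [rewrite cgi ltxx in lt_i | ].
apply: for_each_mono ut => i; rewrite mem_filter => /andP[cgi _].
by move=> s1 t1 [u1 su1 ->]; exists u1; rewrite // /min_post cgi.
Qed.

Lemma min_gens_cell_functional
    (reduce : grade -> 'I_n -> state m n m -> state m n m -> Prop) g :
  (forall i, functional (reduce g i)) -> functional (min_gens_cell cg reduce g).
Proof.
move=> fr; apply: seq_prog_functional; apply: for_each_functional => i //.
by apply: seq_prog_functional => // s t t' -> ->.
Qed.

Lemma min_gens_same_output : same_output (min_gens_gq M) (min_gens_lw M).
Proof.
have [g i Q s u|g i s u|g i s|t [st st']] :=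
  @simulation_init m n m cg (@cgrade_colex _ _ _ _ M) min_post _ _ _
    _ min_members_sorted mem_min_members
    X Y (@cgrade_grid _ _ _ _ M) (gmx M) 1%:M [::].
- by rewrite /min_post; case: ifP.
- by rewrite /min_post; case: ifP => _; [eexists | exists (output u); case: u].
- by rewrite /min_post => /negbTE ->.
have {}st := queue_loop_mono (@min_gens_cellP _) st.
have {}st' := for_each_mono (fun g _ => @min_gens_cellP _ g) st'.
apply: same_output_of_runs st st' _ _ _ => //.
- apply: queue_loop_functional => g; apply: min_gens_cell_functional => i.
  exact: reduce_gq_functional.
- apply: for_each_functional => g; apply: min_gens_cell_functional => i.
  exact: reduce_lw_functional.
Qed.

End Instances.

Theorem propositionB2 (X Y m n : nat) (M : gradedMatrix X Y m n) :
  same_output (min_gens_gq M) (min_gens_lw M) /\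
  same_output (ker_basis_gq M) (ker_basis_lw M).
Proof. by split; [exact: min_gens_same_output | exact: ker_basis_same_output]. Qed.
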